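(* Let $(f,\Lambda)$ be a generic pair on $[0,L]$, let $\Gamma=(f,\Lambda,1)$, and let $\gamma=(a,-1,k)$ be the curve obtained from the bifurcation curve $\gamma_1=(h,k)$ of the magnetic geodesic flow $S(f,\Lambda)$. The tangent line to the curve $\Gamma=(f,\Lambda,1)$ at any point $\Gamma(r)$, $r\in I$, is given by the equation $$a(r)f-\Lambda+k(r)=0$$ (in the plane with coordinates $(f,\Lambda)$). In particular, the coefficients of this equation are computed by the formulas $$a(r)=\frac{\Lambda'(r)}{f'(r)},\qquad k(r)=\Lambda(r)-f(r)\frac{\Lambda'(r)}{f'(r)},\qquad r\in I,$$ expressing the curve $\gamma(r)=(a(r),-1,k(r))$, $r\in I$, in terms of the original curve $\Gamma(r)$. That is, the equality $P\gamma=(P\Gamma|_I)^*$ of projective curves is true.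
   Context: Generic pairs. Fix $L>0$. A pair of $C^\infty$ functions $f,\Lambda:[0,L]\to\mathbb R$ is generic if: (1) $f>0$ on $(0,L)$ and $f$ extends to a smooth odd $2L$-periodic function on $\mathbb R$; (2) $\Lambda$ extends to a smooth even $2L$-periodic function on $\mathbb R$; (3) $f'(0)=1$, $f'(L)=-1$; (4) $f$ and $\Lambda$ are Morse functions (all critical points on $[0,L]$, endpoints included, are non-degenerate); (5) $(\Lambda'(r))^2+(f'(r))^2>0$ on $[0,L]$; (6) the function $f'\Lambda''-f''\Lambda'$ has only simple zeros. The system. $S(f,\Lambda)$ is the Hamiltonian system on $T^*S^2$ with Hamiltonian $H=\frac{p_r^2}{2}+\frac{p_\varphi^2}{2f^2(r)}$, symplectic form $dp_r\wedge dr+dp_\varphi\wedge d\varphi+\Lambda'(r)dr\wedge d\varphi$ and additional first integral $K=p_\varphi+\Lambda(r)$, where $(r,\varphi)\in(0,L)\times\mathbb R/2\pi\mathbb Z$ are coordinates outside the poles. With $I=[0,L]\setminus\{r:f'(r)=0\}$, its bifurcation curve is $$\gamma_1(r)=(h(r),k(r))=\left(\frac12\left(\frac{\Lambda'(r)}{f'(r)}\right)^2,\ \Lambda(r)-f(r)\frac{\Lambda'(r)}{f'(r)}\right),\quad r\in I .$$ The curve $\gamma(r)=(a(r),-1,k(r))$, $r\in I$, is obtained from $\gamma_1$ by putting $a=\pm\sqrt{2h}$, with the sign chosen (so that $a$ is a differentiable function of $r$) in such a way that $k'(r)a'(r)\le0$ on $I$. Projective duality. For a $C^\infty$-parametrized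 curve $\delta(t)\in\mathbb R^3\setminus\{0\}$, $P\delta(t)\in\mathbb RP^2$ is its projectivization and $\delta^*=[\delta,\dot\delta]$ (vector product). The projective curve $(P\delta)^*$ dual to $P\delta$ is the projectivization of $\delta^*$ (extended by continuity to points where $\delta^*=0$, when this is possible). *)

(* Defs.v *)
From HB Require Import structures.
From mathcomp Require Import all_boot all_order all_algebra.
From mathcomp Require Import all_classical all_reals.
From mathcomp Require Import topology normedtype derive.

Set Implicit Arguments.
Unset Strict Implicit.
Unset Printing Implicit Defensive.

Import Order.TTheory GRing.Theory Num.Theory.
Import numFieldTopology.Exports numFieldNormedType.Exports.

Local Open Scope classical_set_scope.
Local Open Scope ring_scope.
Local Open Scope quotient_scope.

(* A function defined on a set [A] of reals is represented by a function on the
   whole line of which only the values on [A] matter.  Accordingly, derivatives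
   are limits of difference quotients taken inside [A]: at the ends of [0, L]
   they are one-sided. *)
Section DerivativeOn.
Variables (R : realType) (V : normedModType R).
Implicit Types (A : set R) (g : R -> V).

Definition diff_quot_on A g (x : R) : set_system V :=
  (y - x)^-1 *: (g y - g x) @[y --> within A x^'].

Definition derivable_on A g (x : R) : Prop := cvg (diff_quot_on A g x).

Definition deriv_on A g (x : R) : V := lim (diff_quot_on A g x).

Definition smooth_on A g : Prop :=
  forall n x, A x -> derivable_on A (iter n (deriv_on A) g) x.

End DerivativeOn.

Section GenericPair.
Variable R : realType.
Implicit Types (L r : R) (f g Lam F : R -> R).

Definition segment L : set R := `[0, L].

Definition smooth F : Prop := forall n x, derivable (derive1n n F) x 1.

Definition odd_fun F : Prop := forall x, F (- x) = - F x.
Definition even_fun F : Prop := forall x, F (- x) = F x.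
Definition periodic_fun (T : R) F : Prop := forall x, F (x + T) = F x.

Definition morse_on A g : Prop :=
  forall r, A r -> deriv_on A g r = 0 -> deriv_on A (deriv_on A g) r != 0.

Definition simple_zeros_on A g : Prop :=
  forall r, A r -> g r = 0 -> deriv_on A g r != 0.

Record generic_pair L f Lam : Prop := GenericPair {
  generic_smooth_f : smooth_on (segment L) f;
  generic_smooth_Lam : smooth_on (segment L) Lam;
  generic_f_gt0 : forall r, 0 < r < L -> 0 < f r;
  generic_f_ext : exists F,
    [/\ smooth F, odd_fun F, periodic_fun (L *+ 2) F
      & {in segment L, F =1 f}];
  generic_Lam_ext : exists F,
    [/\ smooth F, even_fun F, periodic_fun (L *+ 2) F
      & {in segment L, F =1 Lam}];
  generic_df_0 : deriv_on (segment L) f 0 = 1;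
  generic_df_L : deriv_on (segment L) f L = -1;
  generic_morse_f : morse_on (segment L) f;
  generic_morse_Lam : morse_on (segment L) Lam;
  generic_immersion : forall r, segment L r ->
    0 < deriv_on (segment L) Lam r ^+ 2 + deriv_on (segment L) f r ^+ 2;
  generic_simple_zeros :
    let d := deriv_on (segment L) in
    simple_zeros_on (segment L)
      (fun r => d f r * d (d Lam) r - d (d f) r * d Lam r)
}.

End GenericPair.

Section Curves.
Variable R : realType.
Implicit Types (L r : R) (f Lam a : R -> R) (u v w : 'rV[R]_3).
Implicit Types (A : set R) (delta : R -> 'rV[R]_3).

Definition row3 (x y z : R) : 'rV[R]_3 := \row_(j < 3) [:: x; y; z]`_j.

Definition vector_product u v : 'rV[R]_3 :=
  let c w (j : nat) := w ord0 (inord j) in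
  row3 (c u 1%N * c v 2%N - c u 2%N * c v 1%N)
       (c u 2%N * c v 0%N - c u 0%N * c v 2%N)
       (c u 0%N * c v 1%N - c u 1%N * c v 0%N).

Definition reg_set L f : set R :=
  segment L `\` [set r | deriv_on (segment L) f r = 0].

(* [bif_curve L f Lam r = (h(r), k(r))] is the bifurcation curve, in the (H, K)
   plane, of the system with H = p_r^2 / 2 + p_phi^2 / (2 f^2),
   K = p_phi + Lam and symplectic form
   dp_r /\ dr + dp_phi /\ dphi + Lam' dr /\ dphi; meaningful on [reg_set L f]. *)
Definition bif_curve L f Lam r : R * R :=
  let q := deriv_on (segment L) Lam r / deriv_on (segment L) f r in
  (2^-1 * q ^+ 2, Lam r - f r * q).

Definition bif_h L f Lam r : R := (bif_curve L f Lam r).1.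
Definition bif_k L f Lam r : R := (bif_curve L f Lam r).2.

Record signed_root L f Lam a : Prop := SignedRoot {
  signed_root_pm : forall r, reg_set L f r ->
    a r = Num.sqrt (2 * bif_h L f Lam r) \/
    a r = - Num.sqrt (2 * bif_h L f Lam r);
  signed_root_derivable : forall r, reg_set L f r ->
    derivable_on (reg_set L f) a r;
  signed_root_le0 : forall r, reg_set L f r ->
    deriv_on (reg_set L f) (bif_k L f Lam) r * deriv_on (reg_set L f) a r <= 0
}.

Definition gamma_curve L f Lam a r : 'rV[R]_3 :=
  row3 (a r) (-1) (bif_k L f Lam r).

Definition Gamma_curve f Lam r : 'rV[R]_3 := row3 (f r) (Lam r) 1.

Definition tangent_line A delta r : set 'rV[R]_3 :=
  [set delta r + t *: deriv_on A delta r | t in [set: R]].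

(* The plane with coordinates (x, y) sits in the 3-space as {(x, y, 1)}. *)
Definition affine_line (a b c : R) : set 'rV[R]_3 :=
  [set row3 p.1 p.2 1 | p in [set p : R * R | a * p.1 + b * p.2 + c = 0]].

Definition dual_curve A delta r : 'rV[R]_3 :=
  vector_product (delta r) (deriv_on A delta r).

End Curves.

(* The real projective plane, as the topological quotient of the nonzero
   vectors by proportionality. *)
Section ProjectivePlane.
Variable R : realType.

Definition nonzero3 : set 'rV[R]_3 := [set v | v != 0].

Definition nzvec : Type := set_type nonzero3.
HB.instance Definition _ := Topological.on nzvec.
HB.instance Definition _ := SubChoice.on nzvec.

Fact row001_nonzero3 : row3 0 0 (1 : R) \in nonzero3.
Proof.
rewrite inE /nonzero3 /=; apply/eqP => /rowP /(_ ord_max) /eqP.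
by rewrite !mxE /= oner_eq0.
Qed.

Definition nzvec001 : nzvec := exist (fun v => is_true (v \in nonzero3)) _ row001_nonzero3.
HB.instance Definition _ := isPointed.Build nzvec nzvec001.

Definition proportional (u v : nzvec) : bool :=
  `[< exists2 c : R, c != 0 & val u = c *: val v >].

Fact proportional_refl : reflexive proportional.
Proof. by move=> u; apply/asboolP; exists 1; rewrite ?oner_eq0 ?scale1r. Qed.

Fact proportional_sym : symmetric proportional.
Proof.
suff h u v : proportional u v -> proportional v u.
  by move=> u v; apply/idP/idP; exact: h.
move=> /asboolP[c c0 uv]; apply/asboolP; exists c^-1; first by rewrite invr_eq0.
by rewrite uv scalerA mulVf// scale1r.
Qed.

Fact proportional_trans : transitive proportional.
Proof.
move=> v u w /asboolP[c c0 uv] /asboolP[d d0 vw]; apply/asboolP.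
by exists (c * d); [rewrite mulf_neq0|rewrite uv vw scalerA].
Qed.

Canonical proportional_equiv : equiv_rel nzvec :=
  EquivRel proportional
    proportional_refl proportional_sym proportional_trans.

Definition RP2 : Type := quotient_topology {eq_quot proportional}.

(* Meaningful for [v != 0]; the zero vector gets a default value. *)
Definition projectivize (v : 'rV[R]_3) : RP2 :=
  \pi_({eq_quot proportional}) (insubd nzvec001 v).

Definition proj_curve (delta : R -> 'rV[R]_3) (r : R) : RP2 :=
  projectivize (delta r).

(* Where [dual_curve A delta] vanishes, the value is the limit along the points
   of [A] where it does not vanish. *)
Definition proj_dual (A : set R) (delta : R -> 'rV[R]_3) (r : R) : RP2 :=
  let D := A `&` [set s | dual_curve A delta s != 0] in
  if dual_curve A delta r != 0 then projectivize (dual_curve A delta r)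
  else lim (projectivize (dual_curve A delta s) @[s --> within D r^']).

End ProjectivePlane.

(* Main.v *)
Require Import Defs.
From mathcomp Require Import all_boot all_order all_algebra.
From mathcomp Require Import all_classical all_reals.
From mathcomp Require Import topology normedtype derive.
From mathcomp Require Import ring lra.

Import Order.TTheory GRing.Theory Num.Theory.
Import numFieldTopology.Exports numFieldNormedType.Exports.

(** With q = Lam' / f', both branches of the square root agree with q up to
    sign, and k' = - f q', so a = q gives k' a' = - f q'^2 <= 0.  Conversely,
    if a differs from q at some point of I then, by continuity, a = - q nearby;
    where moreover f > 0, the inequality k' a' = f q'^2 <= 0 forces q' = 0, so
    f' Lam'' - f'' Lam' vanishes on an open interval, against the simplicity of
    its zeros.  Once a = q, the vector product of Gamma and Gamma' is
    - f' (a, -1, k). *)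

Set Implicit Arguments.
Unset Strict Implicit.

Local Open Scope classical_set_scope.
Local Open Scope ring_scope.

(** * Calculus of derivatives taken within a set *)

Section RelativeDerivative.
Context {R : realType}.
Implicit Types (A B : set R) (x c : R).

Lemma near_dnbhs_neq x c : \forall y \near x^', y != c.
Proof.
have [->|xc] := eqVneq x c; first exact: nbhs_dnbhs_neq.
apply: nbhs_dnbhs.
have : y - c @[y --> x] --> x - c.
  by apply: cvgB; [exact: cvg_id|exact: cvg_cst].
move=> /cvgr_neq0; rewrite subr_eq0 => /(_ xc).
by apply: filterS => y; rewrite subr_eq0.
Qed.

Lemma eq_within_dnbhs A B x : (\forall y \near within A x^', B y) ->
  B `<=` A -> within B x^' = within A x^'.
Proof.
rewrite near_withinE => AB BA; apply/seteqP; split=> P; rewrite /within /=.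
  by move: AB; apply: filterS2 => y AB BP /[dup] /AB /BP.
by apply: filterS => y AP /BA.
Qed.

Section Vector.
Context {V : normedModType R}.
Implicit Types (g h : R -> V) (l m : V).

(** Uniqueness of the limit needs a proper filter, that is, [x] must be an accumulation point of
    [A]. *)
Lemma deriv_on_eq A g x l : ProperFilter (within A x^') ->
  diff_quot_on A g x --> l -> deriv_on A g x = l.
Proof. by move=> FA gl; rewrite /deriv_on; apply: norm_cvg_lim. Qed.

Lemma eq_cvg_diff_quot_on A g h x l : g x = h x ->
  (\forall y \near within A x^', g y = h y) ->
  diff_quot_on A g x --> l -> diff_quot_on A h x --> l.
Proof.
move=> ghx gh; apply: cvg_trans; apply: near_eq_cvg.
by apply: filterS gh => y ->; rewrite ghx.
Qed.

Lemma cvg_diff_quot_onD A g h x l m :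
  diff_quot_on A g x --> l -> diff_quot_on A h x --> m ->
  diff_quot_on A (fun y => g y + h y) x --> l + m.
Proof.
move=> gl hm; apply: cvg_trans (cvgD gl hm); apply: near_eq_cvg.
by apply: nearW => y /=; rewrite fctE -scalerDr opprD addrACA.
Qed.

(** Differentiability implies continuity: [g y] is [g x] plus [y - x] times the difference
    quotient. *)
Lemma cvg_within_dnbhs A g x l : diff_quot_on A g x --> l ->
  g y @[y --> within A x^'] --> g x.
Proof.
move=> gl.
have yx : y - x @[y --> within A x^'] --> x - x.
  apply: cvgB; last exact: cvg_cst.
  by move=> P Px; apply: cvg_within; exact: nbhs_dnbhs.
rewrite -[X in _ --> X]addr0 -(scale0r l) -(subrr x).
apply: cvg_trans (cvgD (cvg_cst (g x)) (cvgZ yx gl)); apply: near_eq_cvg.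
apply: cvg_within; near=> y.
have yxN : y - x != 0 by rewrite subr_eq0; near: y; exact: nbhs_dnbhs_neq.
by rewrite fctE/= scalerA divff// scale1r addrC subrK.
Unshelve. all: by end_near. Qed.

End Vector.

Implicit Types (g h : R -> R) (l m : R).

Lemma cvg_diff_quot_onM A g h x l m :
  diff_quot_on A g x --> l -> diff_quot_on A h x --> m ->
  diff_quot_on A (fun y => g y * h y) x --> l * h x + g x * m.
Proof.
move=> gl hm; have hx := cvg_within_dnbhs hm.
apply: cvg_trans (cvgD (cvgM gl hx) (cvgM (cvg_cst (g x)) hm)).
apply: near_eq_cvg.
by apply: nearW => y /=; rewrite !fctE /GRing.scale/=; ring.
Qed.

Lemma cvg_diff_quot_onN A g x l :
  diff_quot_on A g x --> l -> diff_quot_on A (fun y => - g y) x --> - l.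
Proof.
move=> gl; apply: cvg_trans (cvgN gl); apply: near_eq_cvg.
by apply: nearW => y /=; rewrite !fctE /GRing.scale/=; ring.
Qed.

Lemma cvg_diff_quot_on_div A g h x l m : h x != 0 ->
  diff_quot_on A g x --> l -> diff_quot_on A h x --> m ->
  diff_quot_on A (fun y => g y / h y) x --> (h x * l - m * g x) / h x ^+ 2.
Proof.
move=> hx0 gl hm; have hx := cvg_within_dnbhs hm.
(* This form mirrors the difference quotient of [g / h]: that of [g] minus [g x / h x] times that of
   [h], all divided by [h y]. *)
have -> : (h x * l - m * g x) / h x ^+ 2 = (l - g x / h x * m) / h x.
  by field.
apply: cvg_trans
  (cvgM (cvgB gl (cvgM (cvg_cst (g x / h x)) hm)) (cvgV hx0 hx)).
apply: near_eq_cvg.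
near=> y.
have hy0 : h y != 0 by near: y; exact: cvgr_neq0 hx hx0.
rewrite /GRing.scale/= !fctE/=.
(* With the inverse abstracted, [field] does not ask for [y - x != 0]. *)
set t := (y - x)^-1.
by field; rewrite hx0 hy0.
Unshelve. all: by end_near. Qed.

End RelativeDerivative.

(** * Derivatives on the segment and on [I] *)

Section GenericPairs.
Variables (R : realType) (L : R) (f Lam : R -> R).
Hypothesis L_gt0 : 0 < L.
Hypothesis generic : generic_pair L f Lam.
Implicit Types (r s : R).

Local Notation S := (segment L).
Local Notation I := (reg_set L f).
Local Notation d := (deriv_on S).

Definition slope r := d Lam r / d f r.
(** Wronskian of [f'] and [Lam']: the numerator of the derivative of [slope], and the function whose
    zeros are simple by genericity. *)
Definition wronskian r := d f r * d (d Lam) r - d (d f) r * d Lam r.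

Lemma segmentE r : S r = (0 <= r <= L).
Proof. by rewrite /segment/= in_itv. Qed.

(** As [0 < L], a point [r < L] is approached from the right inside the segment, and [r = L] from
    the left. *)
Lemma within_segment_proper r : S r -> ProperFilter (within S r^').
Proof.
rewrite segmentE => /andP[r0 rL].
split; last exact: within_filter.
move=> SN; have {}SN : \forall s \near r, s != r -> S s -> False by [].
have [rL'|Lr] := ltP r L.
- have : \forall s \near r^'+, False.
    near=> s; have rs : r < s by near: s; exact: nbhs_right_gt.
    have sL : s < L by near: s; exact: nbhs_right_lt.
    have : s != r -> S s -> False by near: s; exact: cvg_within.
    by rewrite gt_eqF// segmentE (le_trans r0 (ltW rs)) ltW//; apply.
  by move=> /filter_ex[].
- have : \forall s \near r^'-, False.
    near=> s; have rs : s < r by near: s; exact: nbhs_left_lt.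
    have s0 : 0 < s by near: s; apply: nbhs_left_gt; exact: lt_le_trans Lr.
    have : s != r -> S s -> False by near: s; exact: cvg_within.
    by rewrite lt_eqF// segmentE (ltW s0) (le_trans (ltW rs) rL); apply.
  by move=> /filter_ex[].
Unshelve. all: by end_near. Qed.

Lemma reg_set_segment r : I r -> S r.
Proof. by case. Qed.

Lemma reg_set_neq0 r : I r -> d f r != 0.
Proof. by case=> _ /eqP. Qed.

Lemma cvg_diff_quot_f r : S r -> diff_quot_on S f r --> d f r.
Proof. exact: (generic_smooth_f generic (n := 0)). Qed.

Lemma cvg_diff_quot_df r : S r -> diff_quot_on S (d f) r --> d (d f) r.
Proof. exact: (generic_smooth_f generic (n := 1)). Qed.

Lemma cvg_diff_quot_Lam r : S r -> diff_quot_on S Lam r --> d Lam r.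
Proof. exact: (generic_smooth_Lam generic (n := 0)). Qed.

Lemma cvg_diff_quot_dLam r : S r -> diff_quot_on S (d Lam) r --> d (d Lam) r.
Proof. exact: (generic_smooth_Lam generic (n := 1)). Qed.

(** [I] is relatively open in the segment: [f'] is differentiable, hence continuous, so it stays
    nonzero near [r]. *)
Lemma near_reg_set r : I r -> \forall s \near within S r^', I s.
Proof.
move=> Ir; have Sr := reg_set_segment Ir.
have df_cvg := cvg_within_dnbhs (cvg_diff_quot_df Sr).
have df0 : \forall s \near within S r^', d f s != 0.
  exact: cvgr_neq0 df_cvg (reg_set_neq0 Ir).
apply: filterS2 (near_withinT S (dnbhs_filter r)) df0.
by move=> s Ss /eqP.
Qed.

(** At points of [I], this reduces derivatives within [I] to derivatives within the segment. *)
Lemma within_reg_set r : I r -> within I r^' = within S r^'.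
Proof.
by move=> Ir; apply: eq_within_dnbhs; [exact: near_reg_set
  |exact: reg_set_segment].
Qed.

Lemma diff_quot_reg_set (V : normedModType R) (g : R -> V) r :
  I r -> diff_quot_on I g r = diff_quot_on S g r.
Proof. by move=> Ir; rewrite /diff_quot_on within_reg_set. Qed.

Lemma deriv_reg_set (V : normedModType R) (g : R -> V) r (l : V) :
  I r -> diff_quot_on S g r --> l -> deriv_on I g r = l.
Proof.
move=> Ir gl; apply: deriv_on_eq; last by rewrite diff_quot_reg_set.
rewrite within_reg_set//.
by apply: within_segment_proper; exact: reg_set_segment.
Qed.

Lemma cvg_slope r : I r ->
  diff_quot_on S slope r --> wronskian r / d f r ^+ 2.
Proof.
move=> Ir; have Sr := reg_set_segment Ir.
by apply: cvg_diff_quot_on_div; [exact: reg_set_neq0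
  |exact: cvg_diff_quot_dLam Sr
  |exact: cvg_diff_quot_df Sr].
Qed.

(** With [q = slope], the derivative is [Lam' - f' q - f q'], and [f' q = Lam'] leaves only the last
    term. *)
Lemma cvg_bif_k r : I r ->
  diff_quot_on S (bif_k L f Lam) r --> - (f r * (wronskian r / d f r ^+ 2)).
Proof.
move=> Ir; have Sr := reg_set_segment Ir.
have df0 := reg_set_neq0 Ir.
have f1 := cvg_diff_quot_f Sr.
have Lam1 := cvg_diff_quot_Lam Sr.
have -> : - (f r * (wronskian r / d f r ^+ 2)) =
    d Lam r - (d f r * slope r + f r * (wronskian r / d f r ^+ 2)).
  by rewrite opprD addrA /slope [d f r * _]mulrC divfK// subrr add0r.
exact: cvg_diff_quot_onD Lam1
  (cvg_diff_quot_onN (cvg_diff_quot_onM f1 (cvg_slope Ir))).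
Qed.

(** At the ends the odd periodic extension vanishes: [F 0 = - F 0], and [F L = F (- L) = - F L]. *)
Lemma generic_f_ge0 r : S r -> 0 <= f r.
Proof.
have [F [_ Fodd Fper FE]] := generic_f_ext generic.
have in_S s : 0 <= s <= L -> F s = f s.
  by move=> s0L; apply: FE; rewrite inE segmentE.
rewrite segmentE => /andP[r0 rL].
have [r_gt0|r_le0] := ltP 0 r; last first.
  have -> : r = 0 by apply/le_anti; rewrite r_le0.
  have := Fodd 0; rewrite oppr0 -in_S ?lexx ?(ltW L_gt0)// => ?; lra.
have [r_ltL|r_geL] := ltP r L.
  by rewrite ltW// (generic_f_gt0 generic)// r_gt0.
have -> : r = L by apply/le_anti; rewrite rL.
have := Fper (- L); have -> : - L + L *+ 2 = L by ring.
rewrite Fodd -in_S ?lexx ?(ltW L_gt0)// => ?; lra.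
Qed.

(** * The choice of sign in the square root *)

Lemma sqrt_bif_h r : Num.sqrt (2 * bif_h L f Lam r) = `|slope r|.
Proof. by rewrite /bif_h/= mulVKf ?pnatr_eq0// sqrtr_sqr. Qed.

Lemma signed_root_slope : signed_root L f Lam slope.
Proof.
split=> r Ir.
- rewrite sqrt_bif_h; have [_|_] := ger0P (slope r); first by left.
  by right; rewrite opprK.
- rewrite /derivable_on diff_quot_reg_set//; apply/cvg_ex.
  by exists (wronskian r / d f r ^+ 2); exact: cvg_slope.
- rewrite (deriv_reg_set Ir (cvg_bif_k Ir)) (deriv_reg_set Ir (cvg_slope Ir)).
  rewrite mulNr oppr_le0 -mulrA mulr_ge0 ?sqr_ge0//.
  exact: generic_f_ge0 (reg_set_segment Ir).
Qed.

Lemma signed_root_unique a r : signed_root L f Lam a -> I r -> a r = slope r.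
Proof.
move=> [apm aD ale] Ir; apply/eqP; apply: contrapT => /negP ar.
(* Both admissible values are [slope s] up to sign, so a value other than [slope s] is its
   opposite. *)
have aN s : I s -> a s != slope s -> a s = - slope s.
  move=> Is; case: (apm s Is) => ->; rewrite sqrt_bif_h;
    by have [_|_] := ger0P (slope s); rewrite ?opprK ?eqxx.
(* By continuity of [a] and [slope], this set of disagreement is relatively open in the segment. *)
pose B := [set s | I s /\ a s != slope s].
have B_near s : B s -> \forall t \near within S s^', B t.
  move=> [Is as_].
  have a_cvg : a t @[t --> within S s^'] --> a s.
    by apply: cvg_within_dnbhs; rewrite -diff_quot_reg_set//; exact: aD.
  have q_cvg := cvg_within_dnbhs (cvg_slope Is).
  have aq0 : \forall t \near within S s^', a t - slope t != 0.
    by apply: cvgr_neq0 (cvgB a_cvg q_cvg) _; rewrite subr_eq0.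
  near=> t; split; first by near: t; exact: near_reg_set.
  by rewrite -subr_eq0; near: t.
(* Since [a = - slope] near [s], the sign condition bounds [f] times the square of [slope'] above by
   0, and [f s > 0] at interior points. *)
have B_wronskian s : B s -> 0 < s < L -> wronskian s = 0.
  move=> Bs s0L; have [Is as_] := Bs.
  have a_slope : diff_quot_on S a s --> - (wronskian s / d f s ^+ 2).
    apply: eq_cvg_diff_quot_on (cvg_diff_quot_onN (cvg_slope Is)).
      by rewrite aN.
    by apply: filterS (B_near s Bs) => t [It at_]; rewrite aN.
  have := ale s Is.
  rewrite (deriv_reg_set Is (cvg_bif_k Is)) (deriv_reg_set Is a_slope).
  rewrite mulrNN -mulrA pmulr_rle0; last exact: generic_f_gt0 generic _ s0L.
  rewrite -expr2 => w_le0; apply/eqP.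
  have : wronskian s / d f s ^+ 2 == 0.
    by rewrite -sqrf_eq0 eq_le w_le0 sqr_ge0.
  by rewrite mulf_eq0 invr_eq0 sqrf_eq0 (negPf (reg_set_neq0 Is)) orbF.
have B_inner s : B s -> \forall t \near within S s^', B t /\ 0 < t < L.
  move=> Bs; near=> t.
  have Bt : B t by near: t; exact: B_near.
  split=> //.
  have t0 : t != 0 by near: t; apply: cvg_within; exact: near_dnbhs_neq.
  have tL : t != L by near: t; apply: cvg_within; exact: near_dnbhs_neq.
  have [/reg_set_segment] := Bt; rewrite segmentE => /andP[t_ge0 t_leL] _.
  by rewrite !lt_neqAle t_ge0 t_leL eq_sym t0 tL.
(* The point [r] may be an end, where [f] vanishes and the sign condition says nothing, so a nearby
   interior point of [B] replaces it. *)
have [s [Bs s0L]] : exists s, B s /\ 0 < s < L.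
  have FS := within_segment_proper (reg_set_segment Ir).
  exact: filter_ex (B_inner r (conj Ir ar)).
have ws0 := B_wronskian s Bs s0L.
have Ss : S s by case: Bs => /reg_set_segment.
(* Near [s] the Wronskian is identically zero, so its derivative at [s] is zero too and the zero is
   not simple. *)
have /negP := generic_simple_zeros generic Ss ws0; apply; apply/eqP.
apply: deriv_on_eq; first exact: within_segment_proper.
rewrite -/wronskian.
apply: (@eq_cvg_diff_quot_on _ _ S (cst 0)); first by rewrite /= ws0.
  apply: filterS (B_inner s Bs) => t [Bt t0L].
  by rewrite /= B_wronskian.
rewrite /diff_quot_on; under eq_fun do rewrite subrr scaler0.
exact: cvg_cst.
Unshelve. all: by end_near. Qed.

(** * Tangent lines and dual of the curve [Gamma] *)

Lemma cvg_Gamma_curve r : S r ->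
  diff_quot_on S (Gamma_curve f Lam) r --> row3 (d f r) (d Lam r) 0.
Proof.
move=> Sr.
(* The third coordinate of [Gamma] is constant, so its increments lie in the span of two fixed
   vectors and two scalar limits suffice. *)
have row3E (x y : R) : row3 x y 0 = x *: row3 1 0 0 + y *: row3 0 1 0.
  by apply/rowP => -[[|[|[|]]]] // ?; rewrite !mxE /=; ring.
have D (x y z x' y' z' : R) : row3 x y z - row3 x' y' z' =
    row3 (x - x') (y - y') (z - z').
  by apply/rowP => -[[|[|[|]]]] // ?; rewrite !mxE /=.
rewrite row3E.
apply: cvg_trans; last first.
  exact: cvgD (cvgZr_tmp (a := row3 1 0 0) (cvg_diff_quot_f Sr))
    (cvgZr_tmp (a := row3 0 1 0) (cvg_diff_quot_Lam Sr)).
apply: near_eq_cvg; apply: nearW => s.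
by rewrite fctE /= /Gamma_curve D subrr [in RHS]row3E [RHS]scalerDr !scalerA.
Qed.

Lemma deriv_Gamma_curve r : S r ->
  deriv_on S (Gamma_curve f Lam) r = row3 (d f r) (d Lam r) 0.
Proof.
move=> Sr; have FS := within_segment_proper Sr.
exact: deriv_on_eq (cvg_Gamma_curve Sr).
Qed.

Lemma tangent_line_Gamma r : I r ->
  tangent_line S (Gamma_curve f Lam) r =
    affine_line (slope r) (-1) (bif_k L f Lam r).
Proof.
move=> Ir; have df0 := reg_set_neq0 Ir.
rewrite /tangent_line deriv_Gamma_curve; last exact: reg_set_segment.
have GE t : Gamma_curve f Lam r + t *: row3 (d f r) (d Lam r) 0 =
    row3 (f r + t * d f r) (Lam r + t * d Lam r) 1.
  by apply/rowP => -[[|[|[|]]]] // ?; rewrite !mxE /= ?mulr0 ?addr0.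
apply/seteqP; split=> v /=.
- move=> [t _ <-]; exists (f r + t * d f r, Lam r + t * d Lam r) => //=.
  by rewrite /slope /bif_k /=; field.
(* The first coordinate dictates the parameter; the equation of the line then yields the second
   coordinate. *)
- move=> [[x y] /= xy <-]; exists ((x - f r) / d f r) => //.
  rewrite GE divfK// addrC subrK; congr row3.
  apply/eqP; rewrite -subr_eq0 -xy; apply/eqP.
  by rewrite /slope /bif_k /=; field.
Qed.

(** The vector product of [(f, Lam, 1)] and [(f', Lam', 0)] is [(- Lam', f', f Lam' - Lam f')], from
    which [- f'] factors out. *)
Lemma dual_Gamma r : I r ->
  dual_curve I (Gamma_curve f Lam) r =
    - d f r *: row3 (slope r) (-1) (bif_k L f Lam r).
Proof.
move=> Ir; have df0 := reg_set_neq0 Ir.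
rewrite /dual_curve (deriv_reg_set Ir (cvg_Gamma_curve (reg_set_segment Ir))).
by apply/rowP => -[[|[|[|]]]] // ?; rewrite !mxE !inordK//= /slope /bif_k /=;
  field.
Qed.

End GenericPairs.

(** * Passage to the projective plane *)

Lemma projectivizeZ (R : realType) (c : R) (v : 'rV[R]_3) :
  c != 0 -> v != 0 -> projectivize (c *: v) = projectivize v.
Proof.
move=> c0 v0; apply/eqmodP/asboolP; exists c => //.
(* Both vectors are nonzero, so [insubd] returns them and not its default value. *)
by rewrite !insubdK// inE /nonzero3/= ?scaler_eq0 ?negb_or ?c0.
Qed.

Theorem lemma5p12 (R : realType) (L : R) (f Lam : R -> R)
    (L_gt0 : 0 < L) (generic : generic_pair L f Lam) :
  let I := reg_set L f in
  let Gamma := Gamma_curve f Lam in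
  let k := bif_k L f Lam in
  let df := deriv_on (segment L) f in
  let dLam := deriv_on (segment L) Lam in
  (exists a : R -> R, signed_root L f Lam a) /\
  (forall a : R -> R, signed_root L f Lam a ->
    [/\ forall r, I r ->
          tangent_line (segment L) Gamma r = affine_line (a r) (-1) (k r),
        forall r, I r -> a r = dLam r / df r,
        forall r, I r -> k r = Lam r - f r * (dLam r / df r)
      & forall r, I r ->
          proj_curve (gamma_curve L f Lam a) r = proj_dual I Gamma r]).
Proof.
move=> I Gamma k df dLam; split.
  by eexists; exact: signed_root_slope L_gt0 generic.
move=> a a_root.
have aE r : I r -> a r = dLam r / df r.
  exact: signed_root_unique L_gt0 generic _ _ a_root.
split=> // r Ir; first by rewrite aE//; exact: tangent_line_Gamma.
have gamma0 : row3 (dLam r / df r) (-1) (k r) != 0.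
  apply/eqP => /rowP/(_ (inord 1))/eqP.
  by rewrite !mxE inordK//= oppr_eq0 oner_eq0.
have df0 : - df r != 0 by rewrite oppr_eq0; exact: reg_set_neq0 Ir.
(* On [I] the dual curve is a nonzero multiple of a vector with middle coordinate [-1], so
   [proj_dual] takes its first branch. *)
rewrite /proj_curve /gamma_curve /proj_dual aE// dual_Gamma//.
by rewrite scaler_eq0 negb_or df0 gamma0/= projectivizeZ.
Qed.
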